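(* Let $m \ge 1$ be an integer, $\ell > 0$, and $a > \nu_{m,\ell}$. Let $y_{a,m,\ell}^{+}$ be the larger of the two solutions $y \in (\ell/2,\infty)$ of $h_{m,\ell}(y) = a$, and set $y_n = h_{n,\ell}(y_{a,m,\ell}^{+})$ for $n=0,\dots,m-1$. Then the PTC minimal surface $$D_{2m+1,\ell}(a, y_{m-1}, y_{m-2}, \dots, y_0, y_0, \dots, y_{m-2}, y_{m-1}, a)$$ is stable.
   Context: For $\ell>0$ and $x_0,x_1>0$ put $S_{1,\ell}(x_0,x_1) = (x_0+x_1)\sqrt{(x_1-x_0)^2+\ell^2}$; $\pi S_{1,\ell}(x_0,x_1)$ is the lateral area of the truncated cone $D_{1,\ell}(x_0,x_1)$ of height $\ell$ whose circular edges have radii $x_0,x_1$ (the discs bounded by these circles are not included). For $x_0,\dots,x_N>0$, $D_{N,\ell}(x_0,\dots,x_N)$ is the surface obtained by attaching successively $D_{1,\ell}(x_0,x_1),\dots,D_{1,\ell}(x_{N-1},x_N)$ along the common circles; it is called a piecewise truncated conical (PTC) surface. Its area is $\pi S_{N,\ell}(x_0,\dots,x_N)$ where $S_{N,\ell}(x_0,\dots,x_N) = \sum_{i=1}^N S_{1,\ell}(x_{i-1},x_i)$. For fixed $a,b>0$ and $k \ge 0$, a PTC surface $D_{k+2,\ell}(a,x_0^{(0)},\dots,x_k^{(0)},b)$ is called minimal if $(x_0^{(0)},\dots,x_k^{(0)})$ is a critical point of the function $(x_0,\dots,x_k)\mapsto S_{k+2,\ell}(a,x_0,\dots,x_k,b)$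 of the $k+1$ positive interior radii. A PTC minimal surface $D_{k+2,\ell}(a,x_0^{(0)},\dots,x_k^{(0)},b)$ is called stable if and only if the Hessian matrix of this function is positive definite at $(x_0^{(0)},\dots,x_k^{(0)})$. For integers $n\ge0$ and $y>\ell/2$, $$h_{n,\ell}(y) = \frac{(2y+\ell)^{2n+1} + (2y-\ell)^{2n+1}}{4(4y^2-\ell^2)^n}.$$ For $n\ge1$, $\nu_{n,\ell}$ denotes the minimum of $h_{n,\ell}$ on $(\ell/2,\infty)$; for $a>\nu_{n,\ell}$ the equation $h_{n,\ell}(y)=a$ has exactly two solutions in $(\ell/2,\infty)$. *)

(* Defs.v *)
From HB Require Import structures.
From mathcomp Require Import all_boot all_order all_algebra.
From mathcomp Require Import all_classical all_reals all_analysis.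

Set Implicit Arguments.
Unset Strict Implicit.
Unset Printing Implicit Defensive.

Import Order.TTheory GRing.Theory Num.Theory.
Import numFieldNormedType.Exports.

Local Open Scope ring_scope.
Local Open Scope classical_set_scope.

Definition is_minimum (R : realType) (A : set R) (x : R) : Prop :=
  A x /\ lbound A x.

Definition is_maximum (R : realType) (A : set R) (x : R) : Prop :=
  A x /\ ubound A x.

Definition critical_point (R : realType) (n : nat) (F : 'rV[R]_n -> R)
    (x : 'rV[R]_n) : Prop :=
  differentiable F x /\ forall v : 'rV[R]_n, 'd F x v = 0.

Definition hessian (R : realType) (n : nat) (F : 'rV[R]_n -> R)
    (x : 'rV[R]_n) : 'M[R]_n :=
  \matrix_(i < n, j < n)
    'D_(delta_mx 0 i : 'rV[R]_n)
      (fun z : 'rV[R]_n => 'D_(delta_mx 0 j : 'rV[R]_n) F z) x.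

Definition posdefmx (R : realType) (n : nat) (A : 'M[R]_n) : Prop :=
  A^T = A /\ forall v : 'rV[R]_n, v != 0 -> 0 < (v *m A *m v^T) 0 0.

(* A truncated cone of height l and radii x0, x1 has lateral area
   pi * S1 l x0 x1, so the PTC surface with radii x 0 0, ..., x 0 N has area
   pi * SN l x. A PTC surface is represented by l and its vector of radii. *)
Definition S1 (R : realType) (l x0 x1 : R) : R :=
  (x0 + x1) * Num.sqrt ((x1 - x0) ^+ 2 + l ^+ 2).

Definition SN (R : realType) (N : nat) (l : R) (x : 'rV[R]_N.+1) : R :=
  \sum_(i < N) S1 l (x 0 (inord i)) (x 0 (inord i.+1)).

(* The radii (a, x_0, ..., x_k, b). *)
Definition with_ends (R : realType) (k : nat) (a : R) (x : 'rV[R]_k.+1) (b : R)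
    : 'rV[R]_k.+3 :=
  \row_(i < k.+3)
    if i == 0%N :> nat then a
    else if i == k.+2 :> nat then b
    else x 0 (inord i.-1).

(* SN is given by the same formula on all of R^(k+1); positivity of the radii is
   imposed at the point x, and positive vectors form an open set, so the
   derivatives at x are those of the restriction to positive radii. *)
Definition PTC_minimal (R : realType) (k : nat) (l a b : R)
    (x : 'rV[R]_k.+1) : Prop :=
  (forall i : 'I_k.+3, 0 < with_ends a x b 0 i) /\
  critical_point (fun z : 'rV[R]_k.+1 => SN l (with_ends a z b)) x.

Definition PTC_stable (R : realType) (k : nat) (l a b : R)
    (x : 'rV[R]_k.+1) : Prop :=
  PTC_minimal l a b x /\
  posdefmx (hessian (fun z : 'rV[R]_k.+1 => SN l (with_ends a z b)) x).

Definition h (R : realType) (n : nat) (l y : R) : R :=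
  ((2 * y + l) ^+ (2 * n + 1) + (2 * y - l) ^+ (2 * n + 1))
    / (4 * (4 * y ^+ 2 - l ^+ 2) ^+ n).

Definition is_nu (R : realType) (n : nat) (l nu : R) : Prop :=
  is_minimum [set h n l y | y in [set y : R | l / 2 < y]] nu.

Definition is_y_plus (R : realType) (a : R) (n : nat) (l y : R) : Prop :=
  is_maximum [set y : R | l / 2 < y /\ h n l y = a] y.

(* (y_{m-1}, ..., y_0, y_0, ..., y_{m-1}), which has length (2m - 1) + 1 = 2m
   when 0 < m. *)
Definition symmetric_radii (R : realType) (m : nat) (y : nat -> R)
    : 'rV[R]_(2 * m).-1.+1 :=
  \row_(i < (2 * m).-1.+1)
    if (i < m)%N then y (m - 1 - i)%N else y (i - m)%N.

(* Main.v *)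
(* In the parameter t = (2y + l) / (2y - l) > 1 the radii are discrete catenaries,
   y_n = (l/2) (t^(n+1) + t^(-n)) / (t - 1), and the slanted edge between y_(n-1)
   and y_n has length (l/2) (t^n + t^(-n)), so everything is rational in t.  With
   y_(-n-1) = y_n the whole chain of radii is one catenary, for every t.  Hence
   the derivative of the chain in t is a Jacobi field: a solution of the three-term
   recurrence given by the Hessian.  By a discrete Picone identity, the Hessian is
   positive definite as soon as this field is positive at all vertices.  The field
   is smallest at the two ends, where it is a negative multiple of dy_m/dt and
   strictly decreasing in t; it vanishes at the minimum of y_m, and y^+ lies on the
   side of that minimum where t is smaller. *)
Require Import Defs.
From HB Require Import structures.
From mathcomp Require Import all_boot all_order all_algebra.
From mathcomp Require Import all_classical all_reals all_analysis.
From mathcomp Require Import zify ring lra.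
Import Order.TTheory GRing.Theory Num.Theory.
Import numFieldNormedType.Exports.
Local Open Scope ring_scope.

Set Implicit Arguments.
Unset Strict Implicit.

(** * Directional derivatives *)

Section Calculus.
Context {R : realType} {V : normedModType R}.
Implicit Types (f g : V -> R) (z v : V) (df dg : R).

(** Reduces a directional derivative to one real variable, where the scalar chain rule applies. *)
Lemma is_derive_line f z v df :
  is_derive z v f df <-> is_derive (0 : R) 1 (fun s : R => f (s *: v + z)) df.
Proof.
have E : (fun s : R => s^-1 *: (f (s *: v + z) - f z)) =
    (fun s : R => s^-1 *: (f ((s *: (1 : R) + 0) *: v + z) - f (0 *: v + z))).
  by apply/funext => s /=; rewrite scale0r add0r addr0 /GRing.scale /= mulr1.
split=> -[h1 h2]; split.
- by move: h1; rewrite /derivable /= E.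
- by move: h2; rewrite /derive /= E.
- by rewrite /derivable /= E.
- by rewrite /derive /= E.
Qed.

Lemma is_derive_comp_scalar (F : R -> R) f z v dF df :
  is_derive (f z) 1 F dF -> is_derive z v f df ->
  is_derive z v (fun x => F (f x)) (dF * df).
Proof.
move=> hF /is_derive_line hf; apply/is_derive_line.
apply: (@is_derive1_comp _ F (fun s : R => f (s *: v + z))) => //.
by rewrite scale0r add0r.
Qed.

Lemma is_derive_add f g z v df dg :
  is_derive z v f df -> is_derive z v g dg ->
  is_derive z v (fun x => f x + g x) (df + dg).
Proof. exact: is_deriveD. Qed.

Lemma is_derive_sub f g z v df dg :
  is_derive z v f df -> is_derive z v g dg ->
  is_derive z v (fun x => f x - g x) (df - dg).
Proof. exact: is_deriveB. Qed.

Lemma is_derive_mul f g z v df dg :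
  is_derive z v f df -> is_derive z v g dg ->
  is_derive z v (fun x => f x * g x) (f z * dg + g z * df).
Proof. exact: is_deriveM. Qed.

Lemma is_derive_const (c : R) z v : is_derive z v (fun _ : V => c) 0.
Proof. exact: is_derive_cst. Qed.

Lemma is_derive_inv f z v df : f z != 0 -> is_derive z v f df ->
  is_derive z v (fun x => (f x)^-1) (- df / f z ^+ 2).
Proof.
move=> fz0 hf.
have hV : is_derive (f z) 1 (fun x : R => x^-1) (- (f z) ^- 2).
  apply: is_derive_eq; first exact: (@is_deriveV _ id (f z) 1 1 fz0).
  by rewrite /= /GRing.scale /= mulr1.
apply: is_derive_eq; first exact: (is_derive_comp_scalar hV hf).
by rewrite mulrC mulrN mulNr.
Qed.

Lemma is_derive_bigsum n (F : 'I_n -> V -> R) (dF : 'I_n -> R) z v :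
  (forall i, is_derive z v (F i) (dF i)) ->
  is_derive z v (fun x => \sum_i F i x) (\sum_i dF i).
Proof. by move=> hF; rewrite -fct_sumE; exact: is_derive_sum. Qed.

Lemma differentiable_bigsum n (F : 'I_n -> V -> R) z :
  (forall i, differentiable (F i) z) ->
  differentiable (fun x => \sum_i F i x) z.
Proof. by move=> hF; rewrite -fct_sumE; exact: differentiable_sum. Qed.

End Calculus.

(** * Area of one truncated cone and its first two derivatives *)

Section Cone.
Context {R : realType}.

Definition slant (l x0 x1 : R) := Num.sqrt ((x1 - x0) ^+ 2 + l ^+ 2).

Lemma sqr_slant (l x0 x1 : R) : slant l x0 x1 ^+ 2 = (x1 - x0) ^+ 2 + l ^+ 2.
Proof. by rewrite sqr_sqrtr // addr_ge0 // sqr_ge0. Qed.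

Lemma slant_gt0 (l x0 x1 : R) : 0 < l -> 0 < slant l x0 x1.
Proof. by move=> l0; rewrite sqrtr_gt0 ltr_wpDl ?sqr_ge0 ?exprn_gt0. Qed.

Definition dS1 (l x0 x1 u0 u1 : R) :=
  (u0 + u1) * slant l x0 x1
  + (x0 + x1) * ((x1 - x0) * (u1 - u0)) / slant l x0 x1.

(** Polarised second derivative of [S1], split into a product of differences and a difference of
    products: the shape that the Picone identity handles. *)
Definition d2S1 (l x0 x1 u0 u1 v0 v1 : R) :=
  (x0 + x1) * l ^+ 2 / slant l x0 x1 ^+ 3 * ((u1 - u0) * (v1 - v0))
  + 2 * (x1 - x0) / slant l x0 x1 * (u1 * v1 - u0 * v0).

Context {V : normedModType R}.
Implicit Types (f g : V -> R) (z v : V).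

Lemma is_derive_slant (l : R) f g z v (v0 v1 : R) : 0 < l ->
  is_derive z v f v0 -> is_derive z v g v1 ->
  is_derive z v (fun x => slant l (f x) (g x))
    ((g z - f z) * (v1 - v0) / slant l (f z) (g z)).
Proof.
move=> l0 hf hg.
have hd := is_derive_sub hg hf.
have hq := is_derive_add (is_derive_mul hd hd) (is_derive_const (l ^+ 2) z v).
have w0 := slant_gt0 (f z) (g z) l0.
have q0 : 0 < (g z - f z) * (g z - f z) + l ^+ 2.
  by rewrite -expr2 -sqr_slant exprn_gt0.
have hr := is_derive_comp_scalar
  (f := fun x => (g x - f x) * (g x - f x) + l ^+ 2) (is_derive1_sqrt q0) hq.
apply: (is_derive_eq hr).
by rewrite -[Num.sqrt _]/(slant l (f z) (g z)); field; rewrite gt_eqF.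
Qed.

Lemma is_derive_S1 (l : R) f g z v (v0 v1 : R) : 0 < l ->
  is_derive z v f v0 -> is_derive z v g v1 ->
  is_derive z v (fun x => S1 l (f x) (g x)) (dS1 l (f z) (g z) v0 v1).
Proof.
move=> l0 hf hg.
have := is_derive_mul (is_derive_add hf hg) (is_derive_slant l0 hf hg).
move=> /is_derive_eq; apply.
by rewrite /dS1 addrC mulrA [X in X + _]mulrC.
Qed.

Lemma is_derive_dS1 (l : R) f g z v (u0 u1 v0 v1 : R) : 0 < l ->
  is_derive z v f v0 -> is_derive z v g v1 ->
  is_derive z v (fun x => dS1 l (f x) (g x) u0 u1)
    (d2S1 l (f z) (g z) u0 u1 v0 v1).
Proof.
move=> l0 hf hg.
have w0 : slant l (f z) (g z) != 0 by rewrite gt_eqF // slant_gt0.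
have hw := is_derive_slant l0 hf hg.
have hs := is_derive_add hf hg.
have hd := is_derive_sub hg hf.
have hi := is_derive_inv (f := fun x => slant l (f x) (g x)) w0 hw.
have := is_derive_add (is_derive_mul (is_derive_const (u0 + u1) z v) hw)
  (is_derive_mul
     (is_derive_mul hs (is_derive_mul hd (is_derive_const (u1 - u0) z v)))
     hi).
move=> /is_derive_eq; apply.
rewrite /d2S1; set w := slant _ _ _.
(* Eliminating [l ^+ 2] in favour of the root [w] leaves a rational identity. *)
have -> : l ^+ 2 = w ^+ 2 - (g z - f z) ^+ 2 by rewrite sqr_slant addrC addKr.
by field.
Qed.

Lemma differentiable_S1 (l : R) f g z : 0 < l ->
  differentiable f z -> differentiable g z ->
  differentiable (fun x => S1 l (f x) (g x)) z.
Proof.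
move=> l0 hf hg.
have hd : differentiable (g - f) z by exact: differentiableB.
have hs : differentiable (f + g) z by exact: differentiableD.
have hq : differentiable ((g - f) * (g - f) + cst (l ^+ 2)) z.
  by apply: differentiableD; [exact: differentiableM | exact: differentiable_cst].
have hr : differentiable (Num.sqrt \o ((g - f) * (g - f) + cst (l ^+ 2))) z.
  apply: differentiable_comp => //; apply/derivable1_diffP.
  suff /is_derive1_sqrt[] : 0 < ((g - f) * (g - f) + cst (l ^+ 2)) z by [].
  by rewrite /= ltr_wpDl ?exprn_gt0 // -expr2 sqr_ge0.
exact: (differentiableM hs hr).
Qed.

End Cone.

(** * First and second variation of the area *)

Section Surface.
Context {R : realType} (k : nat) (l a b : R).
Implicit Types (x z u v : 'rV[R]_k.+1).
Context (l_gt0 : 0 < l).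

Local Notation area := (fun z : 'rV[R]_k.+1 => SN l (with_ends a z b)).
Local Notation radius z i := (with_ends a z b 0 (inord i)).
(** The end radii are fixed, so a variation is extended by zero at both ends. *)
Local Notation ext v i := (with_ends 0 v 0 0 (inord i)).
Local Notation unit_row j := (delta_mx 0 j : 'rV[R]_k.+1).

Lemma is_derive_coord j z v : is_derive z v (fun x => x 0 j) (v 0 j).
Proof.
apply/is_derive_line.
have -> : (fun s : R => (s *: v + z) 0 j) = (fun s : R => s * v 0 j + z 0 j).
  by apply/funext => s; rewrite !mxE.
have hid : is_derive (0 : R) 1 (fun s : R => s) 1 by exact: is_derive_id.
have hm := is_derive_mul hid (is_derive_const (v 0 j) (0 : R) (1 : R)).
apply: (is_derive_eq (is_derive_add hm (is_derive_const (z 0 j) (0 : R) (1 : R)))).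
by rewrite mulr0 add0r addr0 mulr1.
Qed.

Lemma is_derive_with_ends i z v :
  is_derive z v (fun x => with_ends a x b 0 i) (with_ends 0 v 0 0 i).
Proof.
rewrite mxE; under eq_fun do rewrite mxE.
case: ifP => _; first exact: is_derive_const.
case: ifP => _; first exact: is_derive_const.
exact: is_derive_coord.
Qed.

Lemma differentiable_with_ends i z :
  differentiable (fun x => with_ends a x b 0 i) z.
Proof.
under eq_fun do rewrite mxE.
case: (nat_of_ord i == 0)%N; first exact: differentiable_cst.
case: (nat_of_ord i == k.+2)%N; first exact: differentiable_cst.
exact: differentiable_coord.
Qed.

Lemma with_ends_sum i v :
  with_ends 0 v 0 0 i = \sum_j v 0 j * with_ends 0 (unit_row j) 0 0 i.
Proof.
rewrite mxE; under eq_bigr do rewrite mxE.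
case: ifP => _; first by rewrite big1 // => j _; rewrite mulr0.
case: ifP => _; first by rewrite big1 // => j _; rewrite mulr0.
rewrite (bigD1 (inord i.-1)) //= mxE !eqxx mulr1 big1 ?addr0 // => j /negPf ji.
by rewrite mxE eqxx eq_sym ji mulr0.
Qed.

Definition dSN z v : R :=
  \sum_(i < k.+2) dS1 l (radius z i) (radius z i.+1) (ext v i) (ext v i.+1).

Definition d2SN z u v : R :=
  \sum_(i < k.+2) d2S1 l (radius z i) (radius z i.+1)
    (ext u i) (ext u i.+1) (ext v i) (ext v i.+1).

Lemma is_derive_SN z v : is_derive z v area (dSN z v).
Proof.
rewrite /SN; apply: is_derive_bigsum => i.
by apply: is_derive_S1 => //; exact: is_derive_with_ends.
Qed.

Lemma is_derive_dSN z u v : is_derive z v (dSN ^~ u) (d2SN z u v).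
Proof.
rewrite /dSN; apply: is_derive_bigsum => i.
by apply: is_derive_dS1 => //; exact: is_derive_with_ends.
Qed.

Lemma differentiable_SN z : differentiable area z.
Proof.
rewrite /SN; apply: differentiable_bigsum => i.
by apply: differentiable_S1 => //; exact: differentiable_with_ends.
Qed.

Lemma critical_point_SN z : (forall v, dSN z v = 0) -> critical_point area z.
Proof.
move=> z0; split; first exact: differentiable_SN.
move=> v; rewrite -deriveE; last exact: differentiable_SN.
by have /@derive_val -> := is_derive_SN z v.
Qed.

Lemma hessian_SN z i j :
  hessian area z i j = d2SN z (unit_row j) (unit_row i).
Proof.
rewrite mxE.
under eq_fun => y do have /@derive_val -> := is_derive_SN y (unit_row j).
by have /@derive_val -> := is_derive_dSN z (unit_row j) (unit_row i).
Qed.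

Lemma d2SN_sym z u v : d2SN z u v = d2SN z v u.
Proof. by apply: eq_bigr => i _; rewrite /d2S1; ring. Qed.

(** Linearity over the standard basis; together with symmetry it identifies the matrix form of the
    Hessian at v with [d2SN z v v]. *)
Lemma d2SN_sumr z u v : d2SN z u v = \sum_j v 0 j * d2SN z u (unit_row j).
Proof.
under [RHS]eq_bigr do rewrite mulr_sumr.
rewrite exchange_big /=; apply: eq_bigr => i _.
have E (x0 x1 p q s t : R) : d2S1 l x0 x1 p q s t
    = d2S1 l x0 x1 p q 1 0 * s + d2S1 l x0 x1 p q 0 1 * t by rewrite /d2S1; ring.
rewrite E (with_ends_sum (inord i) v) (with_ends_sum (inord i.+1) v) !mulr_sumr.
rewrite -big_split; apply: eq_bigr => j _ /=.
by rewrite [in RHS]E; ring.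
Qed.

Lemma posdefmx_hessian_SN z :
  (forall v, v != 0 -> 0 < d2SN z v v) -> posdefmx (hessian area z).
Proof.
move=> pos; split.
  by apply/matrixP => i j; rewrite mxE !hessian_SN d2SN_sym.
move=> v /pos; congr (0 < _).
rewrite mxE d2SN_sumr; apply: eq_bigr => j _.
rewrite d2SN_sym d2SN_sumr !mxE mulrC; congr (_ * _).
by apply: eq_bigr => i _; rewrite hessian_SN.
Qed.

End Surface.

(** * Discrete Picone identity *)

Section Picone.
Context {R : realFieldType} (n : nat) (c e phi V : nat -> R).
Context (phi_gt0 : forall i, (i <= n.+1)%N -> 0 < phi i).
(** Jacobi equation: [phi] makes the quadratic form below stationary at each interior vertex. *)
Context (jacobi : forall i, (i < n)%N ->
  c i * (phi i.+1 - phi i) + e i * phi i.+1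
  = c i.+1 * (phi i.+2 - phi i.+1) + e i.+1 * phi i.+1).
Context (V0 : V 0%N = 0).

(* The excess over the sum of squares telescopes by [jacobi]; it is the boundary
   term at [j.+1]. *)
Lemma picone_partial_sum (j : nat) : (j <= n)%N ->
  \sum_(i < j.+1)
    (c i * (V i.+1 - V i) ^+ 2 + e i * (V i.+1 ^+ 2 - V i ^+ 2))
  = \sum_(i < j.+1)
      c i * phi i * phi i.+1 * (V i.+1 / phi i.+1 - V i / phi i) ^+ 2
    + (c j * (phi j.+1 - phi j) / phi j.+1 + e j) * V j.+1 ^+ 2.
Proof.
elim: j => [|j IHj] jn.
  have p0 : phi 0%N != 0 by rewrite gt_eqF ?phi_gt0.
  have p1 : phi 1%N != 0 by rewrite gt_eqF ?phi_gt0.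
  rewrite !big_ord1 V0 /=; field.
  by rewrite p0 p1.
rewrite big_ord_recr [in RHS]big_ord_recr /= IHj ?(ltnW jn) //.
have p1 : phi j.+1 != 0 by rewrite gt_eqF ?phi_gt0 // ltnW.
have p2 : phi j.+2 != 0 by rewrite gt_eqF ?phi_gt0.
have -> : c j * (phi j.+1 - phi j) / phi j.+1 + e j
    = c j.+1 * (phi j.+2 - phi j.+1) / phi j.+1 + e j.+1.
  apply: (mulIf p1); rewrite !mulrDl !divfK //; exact: jacobi.
set s := \sum_(i < j.+1) _.
by field; rewrite p1 p2.
Qed.

(** The boundary term vanishes with [V n.+1], leaving weighted squares. If they sum to zero, the
    quotient V / phi is constant, hence zero because V vanishes at the left end. *)
Lemma picone_gt0 :
  (forall i, (i <= n)%N -> 0 < c i) -> V n.+1 = 0 ->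
  (exists2 i, (i <= n.+1)%N & V i != 0) ->
  0 < \sum_(i < n.+1)
    (c i * (V i.+1 - V i) ^+ 2 + e i * (V i.+1 ^+ 2 - V i ^+ 2)).
Proof.
move=> c_gt0 Vn [k kn Vk].
rewrite picone_partial_sum // Vn expr0n mulr0 addr0.
have coef_gt0 (i : 'I_n.+1) : 0 < c i * phi i * phi i.+1.
  have ltin := ltn_ord i.
  by rewrite !mulr_gt0 ?c_gt0 ?phi_gt0 // ltnW.
have term_ge0 (i : 'I_n.+1) : true ->
    0 <= c i * phi i * phi i.+1 * (V i.+1 / phi i.+1 - V i / phi i) ^+ 2.
  by move=> _; rewrite mulr_ge0 ?sqr_ge0 // ltW.
rewrite lt0r sumr_ge0 // andbT; apply: contra Vk => /eqP sum0.
have step (i : 'I_n.+1) : V i.+1 / phi i.+1 = V i / phi i.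
  have /(_ i isT)/eqP := psumr_eq0P term_ge0 sum0.
  by rewrite mulf_eq0 gt_eqF //= sqrf_eq0 subr_eq0 => /eqP.
have V_phi0 i : (i <= n.+1)%N -> V i / phi i = 0.
  elim: i => [|i IHi] ltin; first by rewrite V0 mul0r.
  by rewrite (step (Ordinal ltin)) IHi // ltnW.
have /eqP := V_phi0 k kn.
by rewrite mulf_eq0 invr_eq0 (gt_eqF (phi_gt0 kn)) orbF.
Qed.

End Picone.

Lemma d2SN_gt0 (R : realType) (k : nat) (l a b : R) (z : 'rV[R]_k.+1)
    (x phi : nat -> R) : 0 < l ->
  (forall i, (i <= k.+2)%N -> with_ends a z b 0 (inord i) = x i) ->
  (forall i, (i <= k.+2)%N -> 0 < x i) ->
  (forall i, (i <= k.+2)%N -> 0 < phi i) ->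
  (forall i, (i < k.+1)%N ->
    (x i + x i.+1) * l ^+ 2 / slant l (x i) (x i.+1) ^+ 3 * (phi i.+1 - phi i)
    + 2 * (x i.+1 - x i) / slant l (x i) (x i.+1) * phi i.+1
    = (x i.+1 + x i.+2) * l ^+ 2 / slant l (x i.+1) (x i.+2) ^+ 3
        * (phi i.+2 - phi i.+1)
      + 2 * (x i.+2 - x i.+1) / slant l (x i.+1) (x i.+2) * phi i.+1) ->
  forall v, v != 0 -> 0 < d2SN l a b z v v.
Proof.
move=> l0 xE x0 phi0 jac v v0.
pose V i : R := with_ends 0 v 0 0 (inord i).
have Vl : V 0%N = 0 by rewrite /V mxE inordK.
have Vr : V k.+2 = 0 by rewrite /V mxE inordK //= eqxx.
have V_neq0 : exists2 i, (i <= k.+2)%N & V i != 0.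
  have [j vj] : exists j, v 0 j != 0.
    apply/existsP; apply: contraR v0; rewrite negb_exists => /forallP vz.
    by apply/eqP/rowP => j; rewrite mxE; apply/eqP; rewrite -[_ == _]negbK.
  have jk := ltn_ord j.
  (* Coordinate j of the variation sits at vertex j + 1, after the left end. *)
  exists j.+1; first by rewrite ltnW.
  by rewrite /V mxE inordK ?ltnS 1?ltnW //= eqSS ltn_eqF // inord_val.
have c0 i : (i <= k.+1)%N ->
    0 < (x i + x i.+1) * l ^+ 2 / slant l (x i) (x i.+1) ^+ 3.
  move=> ik; rewrite divr_gt0 ?exprn_gt0 ?slant_gt0 //.
  by rewrite mulr_gt0 ?exprn_gt0 // addr_gt0 ?x0 // leqW.
have := picone_gt0 phi0 jac Vl c0 Vr V_neq0.
congr (0 < _); apply: eq_bigr => i _; have ik := ltn_ord i.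
by rewrite /d2S1 -/(V i) -/(V i.+1) !xE ?(ltnW ik) // !expr2.
Qed.

(** The hypothesis says that each partial derivative of the area in an interior radius vanishes.
    Summation by parts then leaves only a term at the right end, where the variation is zero. *)
Lemma dSN_eq0 (R : realType) (k : nat) (l a b : R) (z : 'rV[R]_k.+1)
    (x : nat -> R) :
  (forall i, (i <= k.+2)%N -> with_ends a z b 0 (inord i) = x i) ->
  (forall i, (i < k.+1)%N ->
    slant l (x i) (x i.+1)
    + (x i + x i.+1) * (x i.+1 - x i) / slant l (x i) (x i.+1)
    + slant l (x i.+1) (x i.+2)
    - (x i.+1 + x i.+2) * (x i.+2 - x i.+1) / slant l (x i.+1) (x i.+2) = 0) ->
  forall v, dSN l a b z v = 0.
Proof.
move=> xE bal v; pose V i : R := with_ends 0 v 0 0 (inord i).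
have Vl : V 0%N = 0 by rewrite /V mxE inordK.
have Vr : V k.+2 = 0 by rewrite /V mxE inordK //= eqxx.
pose w i := slant l (x i) (x i.+1).
pose p i := w i + (x i + x i.+1) * (x i.+1 - x i) / w i.
have partial j : (j <= k.+1)%N ->
    \sum_(i < j.+1) dS1 l (x i) (x i.+1) (V i) (V i.+1) = p j * V j.+1.
  elim: j => [|j IHj] jk.
    by rewrite big_ord1 Vl /dS1 /p -/(w 0%N); ring.
  rewrite big_ord_recr /= IHj ?(ltnW jk) // /dS1 /p -/(w j.+1).
  have := congr1 ( *%R^~ (V j.+1)) (bal j jk).
  rewrite mul0r -/(w j) -/(w j.+1) => balj.
  by apply/subr0_eq; rewrite -[RHS]balj; ring.
rewrite -[RHS](mulr0 (p k.+1)) -Vr -partial //.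
apply: eq_bigr => i _; have ik := ltn_ord i.
by rewrite -/(V i) -/(V i.+1) !xE // ltnW.
Qed.

(** * Discrete catenaries and their Jacobi field *)

Section Catenary.
Context {R : realType}.
Implicit Types (l t k : R).

(** For tau = t ^ k this is a hyperbolic cosine in k, centred at k = 1/2. Keeping tau as a variable
    makes a shift of k the product t * tau, so that [field] can check the identities. *)
Definition catenary l t (tau : R) := l / 2 * (tau + t / tau) / (t - 1).

(* With tau = t ^ k, this is -(2/l) (t - 1)^2 times the derivative in t of
   [catenary l t (t ^ k)]. *)
Definition jacobi_field t k (tau : R) :=
  tau + t / tau - (t - 1) * (k * tau / t - (k - 1) / tau).

Lemma catenary_gt0 l t tau : 0 < l -> 1 < t -> 0 < tau ->
  0 < catenary l t tau.
Proof.
move=> l0 t1 tau0; have t0 : 0 < t by rewrite (lt_trans ltr01).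
by rewrite /catenary divr_gt0 ?subr_gt0 // mulr_gt0 ?divr_gt0 // addr_gt0 // divr_gt0.
Qed.

(** Consecutive radii differ by l / 2 * (tau - 1 / tau), so adding l ^ 2 to the square gives a
    perfect square. *)
Lemma slant_catenary l t tau : 0 < l -> 1 < t -> 0 < tau ->
  slant l (catenary l t tau) (catenary l t (t * tau))
  = l / 2 * (tau + tau^-1).
Proof.
move=> l0 t1 tau0; have t0 : 0 < t by rewrite (lt_trans ltr01).
rewrite /slant -[RHS]ger0_norm ?mulr_ge0 ?addr_ge0 ?invr_ge0 ?ltW //.
rewrite -sqrtr_sqr; congr Num.sqrt; rewrite /catenary; field.
by rewrite !gt_eqF // subr_gt0.
Qed.

Lemma catenary_balance l t tau : 0 < l -> 1 < t -> 0 < tau ->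
  let x0 := catenary l t tau in
  let x1 := catenary l t (t * tau) in
  let x2 := catenary l t (t * (t * tau)) in
  slant l x0 x1 + (x0 + x1) * (x1 - x0) / slant l x0 x1
  + slant l x1 x2 - (x1 + x2) * (x2 - x1) / slant l x1 x2 = 0.
Proof.
move=> l0 t1 tau0 /=; have t0 : 0 < t by rewrite (lt_trans ltr01).
rewrite !slant_catenary ?mulr_gt0 // /catenary; field.
by rewrite !gt_eqF ?subr_gt0 ?addr_gt0 ?mulr_gt0 ?exprn_gt0 ?ltr01.
Qed.

(** Linearised balance equation. It holds with k and tau independent, since the coefficient of k is
    itself a Jacobi field: it comes from moving tau at fixed t. *)
Lemma jacobi_fieldP l t k tau : 0 < l -> 1 < t -> 0 < tau ->
  let x0 := catenary l t tau in
  let x1 := catenary l t (t * tau) in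
  let x2 := catenary l t (t * (t * tau)) in
  let f0 := jacobi_field t k tau in
  let f1 := jacobi_field t (k + 1) (t * tau) in
  let f2 := jacobi_field t (k + 1 + 1) (t * (t * tau)) in
  (x0 + x1) * l ^+ 2 / slant l x0 x1 ^+ 3 * (f1 - f0)
  + 2 * (x1 - x0) / slant l x0 x1 * f1
  = (x1 + x2) * l ^+ 2 / slant l x1 x2 ^+ 3 * (f2 - f1)
    + 2 * (x2 - x1) / slant l x1 x2 * f1.
Proof.
move=> l0 t1 tau0 /=; have t0 : 0 < t by rewrite (lt_trans ltr01).
rewrite !slant_catenary ?mulr_gt0 // /catenary /jacobi_field; field.
by rewrite !gt_eqF ?subr_gt0 ?addr_gt0 ?mulr_gt0 ?exprn_gt0 ?ltr01.
Qed.

End Catenary.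

(** * Monotonicity and sign of the Jacobi field *)

Section Profile.
Context {R : realType}.
Implicit Types (t s k x y : R) (n m : nat).

Lemma jacobi_field_step t k tau : 0 < t -> 0 < tau ->
  jacobi_field t (k + 1) (t * tau)
  = jacobi_field t k tau - k * ((t - 1) ^+ 2 * (tau + tau^-1) / t).
Proof. by move=> t0 tau0; rewrite /jacobi_field; field; rewrite !gt_eqF. Qed.

(** Reflection of the chain in its middle edge. *)
Lemma jacobi_field_sym t k tau : 0 < t -> 0 < tau ->
  jacobi_field t (1 - k) (t / tau) = jacobi_field t k tau.
Proof. by move=> t0 tau0; rewrite /jacobi_field; field; rewrite !gt_eqF. Qed.

(* The value of the field at the vertex of radius y_n. *)
Definition jacobi_end n t := jacobi_field t n.+1%:R (t ^+ n.+1).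

Lemma jacobi_end0 t : 0 < t -> jacobi_end 0 t = 2.
Proof. by move=> t0; rewrite /jacobi_end /jacobi_field expr1; field; rewrite gt_eqF. Qed.

Lemma jacobi_endS n t : 0 < t ->
  jacobi_end n.+1 t = jacobi_end n t
    - n.+1%:R * ((t - 1) ^+ 2 * (t ^+ n.+1 + t ^- n.+1) / t).
Proof.
by move=> t0; rewrite /jacobi_end exprS -[n.+2%:R]natr1 jacobi_field_step ?exprn_gt0.
Qed.

Lemma lt_addV x y : 1 < x -> x < y -> x + x^-1 < y + y^-1.
Proof.
move=> x1 xy; have y1 := lt_trans x1 xy.
have x0 := lt_trans ltr01 x1; have y0 := lt_trans ltr01 y1.
rewrite -subr_gt0.
have -> : y + y^-1 - (x + x^-1) = (y - x) * (x * y - 1) / (x * y).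
  by field; rewrite !gt_eqF.
by rewrite divr_gt0 ?mulr_gt0 ?subr_gt0 // -[1]mulr1 ltr_pM.
Qed.

(** Since (t - 1) ^ 2 / t = t + 1 / t - 2, this is a product of two nonnegative increasing factors,
    both controlled by [lt_addV]. *)
Lemma jacobi_field_step_incr n t s : 1 < t -> t < s ->
  (t - 1) ^+ 2 * (t ^+ n.+1 + t ^- n.+1) / t
  < (s - 1) ^+ 2 * (s ^+ n.+1 + s ^- n.+1) / s.
Proof.
move=> t1 ts; have s1 := lt_trans t1 ts.
have t0 := lt_trans ltr01 t1; have s0 := lt_trans ltr01 s1.
have E x c : 0 < x -> (x - 1) ^+ 2 * c / x = (x + x^-1 - 2) * c.
  by move=> x0; field; rewrite gt_eqF.
have sub2_ge0 : 0 <= t + t^-1 - 2.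
  have -> : t + t^-1 - 2 = (t - 1) ^+ 2 / t by field; rewrite gt_eqF.
  by rewrite divr_ge0 ?sqr_ge0 ?ltW.
rewrite !E // ltr_pM // ?ltrD2r ?lt_addV // ?exprn_egt1 //.
  by rewrite addr_ge0 ?invr_ge0 ?exprn_ge0 ?ltW.
by rewrite ltr_pXn2r // nnegrE ltW.
Qed.

(** From the constant value 2 at index 0, each step subtracts a positive multiple of an increasing
    function of t. The index starts at 1 because index 0 is constant. *)
Lemma jacobi_end_decr n t s : 1 < t -> t < s ->
  jacobi_end n.+1 s < jacobi_end n.+1 t.
Proof.
move=> t1 ts; have t0 := lt_trans ltr01 t1; have s0 := lt_trans t0 ts.
elim: n => [|n IHn]; rewrite [X in X < _]jacobi_endS // [X in _ < X]jacobi_endS //.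
  by rewrite !jacobi_end0 // ltrD2l ltrN2 ltr_pM2l ?ltr0n // jacobi_field_step_incr.
by rewrite ltrB // ltr_pM2l ?ltr0n // jacobi_field_step_incr.
Qed.

Lemma jacobi_end_le n m t : 0 < t -> (n <= m)%N ->
  jacobi_end m t <= jacobi_end n t.
Proof.
move=> t0 /subnKC <-; elim: (m - n)%N => [|d IHd]; first by rewrite addn0.
rewrite addnS jacobi_endS // (le_trans _ IHd) // lerBlDr lerDl.
rewrite mulr_ge0 ?ler0n // divr_ge0 ?(ltW t0) // mulr_ge0 ?sqr_ge0 // ltW //.
by rewrite addr_gt0 ?invr_gt0 ?exprn_gt0.
Qed.

(** Vertices beyond the middle carry [jacobi_end n] with n <= m, which is at least the end value;
    the other half follows by reflection. *)
Lemma jacobi_field_gt0 m t i : 0 < t -> 0 < jacobi_end m t ->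
  (i <= (2 * m).+1)%N -> 0 < jacobi_field t (i%:R - m%:R) (t ^+ i / t ^+ m).
Proof.
move=> t0 jm im; have tm n : t ^+ n != 0 by rewrite expf_neq0 // gt_eqF.
have [ltmi|leim] := ltnP m i.
  have -> : i = (m + (i - m).-1.+1)%N by lia.
  rewrite natrD exprD addrC addrA addNr add0r mulrC mulKf //.
  by apply: (lt_le_trans jm); apply: jacobi_end_le => //; lia.
rewrite -jacobi_field_sym ?divr_gt0 ?exprn_gt0 //.
have -> : 1 - (i%:R - m%:R) = (m - i).+1%:R :> R.
  by rewrite -natr1 natrB //; ring.
have -> : t / (t ^+ i / t ^+ m) = t ^+ (m - i).+1.
  rewrite exprS -{1}(subnKC leim) exprD; field.
  by rewrite ?tm ?gt_eqF.
by apply: (lt_le_trans jm); apply: jacobi_end_le => //; lia.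
Qed.

(* [catenary l t (t ^+ n.+1)] without the factor l/2. *)
Definition profile n t := (t ^+ n.+1 + t ^- n) / (t - 1).

(** Links the field to the radius: [profile n] is critical exactly where [jacobi_end n] vanishes,
    and has negative derivative where it is positive. *)
Lemma is_derive_profile n t : 1 < t ->
  is_derive t 1 (profile n) (- jacobi_end n t / (t - 1) ^+ 2).
Proof.
move=> t1; have t0 := lt_trans ltr01 t1.
have hX (j : nat) : is_derive t (1 : R) (fun x : R => x ^+ j.+1) (j.+1%:R * t ^+ j).
  have := is_deriveX j.+1 (is_derive_id t (1 : R)).
  by rewrite exprfctE /GRing.scale /= mulr1.
have hid : is_derive t (1 : R) (fun x : R => x) 1 by exact: is_derive_id.
have tn0 : t ^+ n != 0 by rewrite expf_neq0 // gt_eqF.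
have hV : is_derive t (1 : R) (fun x : R => x ^- n) (- n%:R / t ^+ n.+1).
  (* [hX] covers only positive exponents; for n = 0 the inverse power is constant. *)
  case: n tn0 => [|n] tn0.
    under eq_fun do rewrite expr0 invr1.
    by rewrite oppr0 mul0r; exact: is_derive_const.
  apply: (is_derive_eq (is_derive_inv (f := fun x => x ^+ n.+1) tn0 (hX n))).
  by rewrite !exprS; field; rewrite expf_neq0 gt_eqF.
have hd := is_derive_sub hid (is_derive_const 1 t (1 : R)).
have t10 : t - 1 != 0 by rewrite gt_eqF // subr_gt0.
have hi := is_derive_inv (f := fun x => x - 1) t10 hd.
apply: (is_derive_eq (is_derive_mul (is_derive_add (hX n) hV) hi)).
rewrite /jacobi_end /jacobi_field !exprS -natr1; field.
by rewrite t10 tn0 gt_eqF.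
Qed.

End Profile.

(** * Field at the ends, and the radii in the parameter t *)

Section Radii.
Context {R : realType}.
Implicit Types (l a y t s A : R) (i n m : nat).

(** The field vanishes at the minimiser [t0] and strictly decreases, so it suffices that [tp < t0];
    the intermediate value theorem provides a solution left of [t0]. *)
Lemma jacobi_end_gt0 n A (t0 tp : R) :
  1 < t0 -> (forall s, 1 < s -> profile n.+1 t0 <= profile n.+1 s) ->
  profile n.+1 t0 < A ->
  1 < tp -> (forall s, 1 < s -> profile n.+1 s = A -> tp <= s) ->
  0 < jacobi_end n.+1 tp.
Proof.
move=> t01 tmin t0A tp1 tp_le.
have t0_pos := lt_trans ltr01 t01.
have drv s : 1 < s -> derivable (profile n.+1) s 1.
  by move=> s1; have [] := is_derive_profile n.+1 s1.
have crit : jacobi_end n.+1 t0 = 0.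
  have t0in : t0 \in `]1, t0 + 1[ by rewrite in_itv /= t01 ltrDl ltr01.
  have le1 : 1 <= t0 + 1 by lra.
  have := @derive1_at_min _ (profile n.+1) 1 (t0 + 1) t0 le1 _ t0in _.
  case.
  - by move=> s; rewrite in_itv /= => /andP[s1 _]; exact: drv.
  - by move=> s; rewrite in_itv /= => /andP[s1 _]; exact: tmin.
  move=> _; have /@derive_val -> := is_derive_profile n.+1 t01.
  move/eqP; rewrite mulf_eq0 oppr_eq0 invr_eq0 expf_eq0 /=.
  by rewrite [t0 - 1 == 0]gt_eqF ?subr_gt0 // orbF => /eqP.
suff tpt0 : tp < t0 by rewrite -crit jacobi_end_decr.
(* The profile exceeds [(t - 1)^-1], so it takes the value [A] left of [t0]. *)
have prof0 : 0 < profile n.+1 t0.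
  by rewrite divr_gt0 ?subr_gt0 // addr_gt0 ?invr_gt0 ?exprn_gt0.
have A0 := lt_trans prof0 t0A.
have t0V : 0 < (t0 - 1)^-1 by rewrite invr_gt0 subr_gt0.
(* With 1 / (t1 - 1) = d, the summand A makes the profile at [t1] at least A, and the other summand
   places [t1] left of [t0]. *)
pose d := A + (t0 - 1)^-1; have d0 : 0 < d by rewrite addr_gt0.
pose t1 := 1 + d^-1.
have t11 : 1 < t1 by rewrite ltrDl invr_gt0.
have t1t0 : t1 < t0.
  by rewrite -ltrBrDl -[X in _ < X]invrK ltf_pV2 ?posrE // ltrDr.
have prof1 : A <= profile n.+1 t1.
  have -> : profile n.+1 t1 = (t1 ^+ n.+2 + t1 ^- n.+1) * d.
    by rewrite /profile; congr (_ * _); rewrite /t1 [1 + _]addrC addrK invrK.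
  have : 1 <= t1 ^+ n.+2 + t1 ^- n.+1.
    rewrite ler_wpDr ?invr_ge0 ?exprn_ge0 ?exprn_ege1 // ltW //.
    exact: lt_trans t11.
  move/(ler_wpM2r (ltW d0)); apply: le_trans.
  by rewrite mul1r lerDl ltW.
have [||c] := @IVT _ (profile n.+1) _ _ A (ltW t1t0).
- apply: derivable_within_continuous => s; rewrite in_itv /= => /andP[s1 _].
  exact/drv/(lt_le_trans t11).
- by rewrite ge_min le_max prof1 (ltW t0A) orbT.
rewrite in_itv /= => /andP[t1c ct0] pc.
have c1 := lt_le_trans t11 t1c.
rewrite (le_lt_trans (tp_le c c1 pc)) // lt_neqAle ct0 andbT.
by apply: contraTneq t0A => <-; rewrite pc ltxx.
Qed.

Definition ratio l y := (2 * y + l) / (2 * y - l).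

Lemma ratio_gt1 l y : 0 < l -> l / 2 < y -> 1 < ratio l y.
Proof.
move=> l0 yl; have q0 : 0 < 2 * y - l by lra.
by rewrite /ratio ltr_pdivlMr // mul1r; lra.
Qed.

(** Put q = 2y - l. Then 2y + l = t q, 4y^2 - l^2 = t q^2 and l = (t - 1) q / 2, so the powers of q
    cancel up to the factor l / 2. *)
Lemma h_ratio n l y : 0 < l -> l / 2 < y ->
  h n l y = l / 2 * profile n (ratio l y).
Proof.
move=> l0 yl; rewrite /h /profile.
have q0 : 0 < 2 * y - l by lra.
have := ratio_gt1 l0 yl.
have : 2 * y + l = ratio l y * (2 * y - l) by rewrite divfK ?gt_eqF.
move: (ratio l y) => t pE t1; set q := 2 * y - l in q0 pE *.
have -> : 4 * y ^+ 2 - l ^+ 2 = t * q ^+ 2 by rewrite [q ^+ 2]expr2 mulrA -pE /q; ring.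
rewrite pE.
have -> : l = (t - 1) * q / 2 by rewrite mulrBl -pE /q; field.
have t0 := lt_trans ltr01 t1.
have powE (x : R) : x ^+ (2 * n + 1) = x * (x ^+ n) ^+ 2.
  by rewrite addn1 exprS mulnC exprM.
have -> : (t * q ^+ 2) ^+ n = t ^+ n * (q ^+ n) ^+ 2.
  by rewrite exprMn -!exprM mulnC.
rewrite !powE [t ^+ n.+1]exprS !exprMn; field.
by rewrite !expf_neq0 ?gt_eqF // subr_gt0.
Qed.

Lemma ratioK l s : 0 < l -> 1 < s -> ratio l (l / 2 * (s + 1) / (s - 1)) = s.
Proof.
move=> l0 s1; rewrite /ratio; field.
rewrite gt_eqF ?subr_gt0 //=.
by rewrite gt_eqF //; lra.
Qed.

(** The exponent i - m runs through the whole chain; the symmetry k -> 1 - k folds its nonpositive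
    part onto the indices m - i. *)
Lemma catenary_profile l t i m : 0 < t ->
  catenary l t (t ^+ i / t ^+ m)
  = l / 2 * profile (if (i <= m)%N then m - i else i - m.+1)%N t.
Proof.
move=> t0; have tn n : t ^+ n != 0 by rewrite expf_neq0 // gt_eqF.
rewrite /catenary /profile -mulrA.
case: leqP => [leim|ltmi]; congr (_ * (_ / _)).
  rewrite -{1 2}(subnKC leim) exprD exprS; field.
  by rewrite !tn.
rewrite -{1 2}(subnKC ltmi) exprD !exprS; field.
by rewrite !tn gt_eqF.
Qed.

(** As y m = a, the fixed ends continue the pattern of the interior radii. *)
Lemma with_ends_symmetric_radii m a (y : nat -> R) i : (0 < m)%N -> y m = a ->
  (i <= (2 * m).+1)%N ->
  with_ends a (symmetric_radii m y) a 0 (inord i)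
  = y (if (i <= m)%N then m - i else i - m.+1)%N.
Proof.
move=> m0 ym im; rewrite mxE inordK; last by lia.
case: eqP => [->|i0]; first by rewrite /= subn0.
case: eqP => [->|i1].
  rewrite ifN; last by lia.
  by rewrite -ym; congr y; lia.
rewrite mxE inordK; last by lia.
have [leim|ltmi] := leqP i m.
  by rewrite ifT; [congr y; lia|lia].
by rewrite ifN; [congr y; lia|lia].
Qed.

End Radii.

(** * Stability of the symmetric surface *)

Unset Implicit Arguments.

Theorem theorem2p5 (R : realType) (m : nat) (l a nu yp : R)
    (hm : (1 <= m)%N) (hl : 0 < l)
    (hnu : is_nu m l nu) (ha : nu < a)
    (hyp : is_y_plus a m l yp) :
  PTC_stable l a a (symmetric_radii m (fun n : nat => h n l yp)).
Proof.
have [[yp_gt yp_a] yp_max] := hyp.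
have [[y0 y0_gt y0_nu] nu_min] := hnu.
pose t := ratio l yp; have t1 : 1 < t := ratio_gt1 hl yp_gt.
have t0 := lt_trans ltr01 t1.
have l2 : 0 < l / 2 by lra.
have to_y s : 1 < s -> exists2 y, l / 2 < y & ratio l y = s.
  move=> s1; exists (l / 2 * (s + 1) / (s - 1)); last exact: ratioK.
  by rewrite ltr_pdivlMr ?subr_gt0 // ltr_pM2l //; lra.
have end_gt0 : 0 < jacobi_end m t.
  (* The factor l / 2 between [h] and [profile] turns the level a into a / (l / 2); the minimiser of
     [h] becomes that of the profile. *)
  rewrite -(prednK hm); apply: (@jacobi_end_gt0 _ _ (a / (l / 2)) (ratio l y0));
    rewrite ?prednK //.
  - exact: ratio_gt1.
  - move=> s /to_y[y yl <-]; rewrite -(ler_pM2l l2) -!h_ratio // y0_nu.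
    by apply: nu_min; exists y.
  - by rewrite ltr_pdivlMr // mulrC -h_ratio // y0_nu.
  move=> s /to_y[y yl <-] ya.
  have : y <= yp.
    by apply: yp_max; split=> //; rewrite h_ratio // ya mulrC divfK // gt_eqF.
  (* [ratio] is decreasing in y, so the largest solution y gives the smallest t. *)
  move=> yyp; rewrite /t /ratio ler_pdivrMr; last by lra.
  by rewrite mulrAC ler_pdivlMr; [nra|lra].
(* Exponents run from -m to m + 1, centring the chain on the edge between vertices m and m + 1. *)
pose tau i := t ^+ i / t ^+ m; pose x i := catenary l t (tau i).
have tau_gt0 i : 0 < tau i by rewrite divr_gt0 ?exprn_gt0.
have tauS i : tau i.+1 = t * tau i by rewrite /tau exprS mulrA.
pose phi i := jacobi_field t (i%:R - m%:R) (tau i).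
have sizeE : ((2 * m).-1.+2 = (2 * m).+1)%N by lia.
have xE i : (i <= (2 * m).-1.+2)%N ->
    with_ends a (symmetric_radii m (fun n => h n l yp)) a 0 (inord i) = x i.
  move=> ik; have im : (i <= (2 * m).+1)%N by rewrite -sizeE.
  by rewrite with_ends_symmetric_radii // /x catenary_profile // h_ratio.
have x_gt0 i : 0 < x i by exact: catenary_gt0.
split; first split.
- by move=> i; rewrite -[i]inord_val xE // -ltnS.
- apply: critical_point_SN => // v; apply: (dSN_eq0 xE) => i _.
  by rewrite /x !tauS; exact: catenary_balance.
apply: posdefmx_hessian_SN => // v v0.
apply: (d2SN_gt0 (phi := phi) hl xE) => //.
- by move=> i im; apply: jacobi_field_gt0 => //; rewrite -sizeE.
have phiS j : j.+1%:R - m%:R = j%:R - m%:R + 1 :> R by rewrite -natr1 addrAC.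
move=> i _; rewrite /x /phi !tauS !phiS.
exact: jacobi_fieldP.
Qed.
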